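(* Let $k\ge2$, let $\tau\in\mathfrak S_k$, and let $N_{\mathrm{Box}(\tau)}(\pi)$ be the number of occurrences of $\mathrm{Box}(\tau)$ in $\pi$. If $\pi$ is uniformly distributed over $\mathfrak S_n$, where $n\ge k$, then $$\mathbb E\bigl[N_{\mathrm{Box}(\tau)}(\pi)\bigr]=\frac{(n+k-1)(H_n-H_{k-2})-2(n-k+2)}{(k-2)!},$$ where $H_m=\sum_{j=1}^m 1/j$ and $H_0=0$. In particular, for $n\ge 3$, $$\mathbb E\bigl[N_{\mathrm{Box}(123)}(\pi)\bigr]=(n+2)H_n-3n.$$ Moreover, for fixed $n$ and $k$, this expectation is independent of the choice of $\tau\in\mathfrak S_k$: all boxed patterns of length $k$ have the same first moment on $\mathfrak S_n$.
   Context: $\mathfrak S_n$ is the set of permutations $\pi=\pi_1\cdots\pi_n$ of $\{1,\dots,n\}$. For $\tau\in\mathfrak S_k$, an occurrence of the boxed pattern $\mathrm{Box}(\tau)$ in $\pi\in\mathfrak S_n$ is a choice of positions $i_1<\cdots<i_k$ such that $\pi_{i_1}\cdots\pi_{i_k}$ is order-isomorphic to $\tau$ and there is no index $j\notin\{i_1,\dots,i_k\}$ with $i_1<j<i_k$ and $\min_r \pi_{i_r}<\pi_j<\max_r\pi_{i_r}$. *)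

(* Defs.v *)
From HB Require Import structures.
From mathcomp Require Import all_boot all_order all_algebra all_fingroup.

Set Implicit Arguments.
Unset Strict Implicit.
Unset Printing Implicit Defensive.

Import GRing.Theory.

(* Permutations of {1, ..., n} are shifted to 'S_n = {perm 'I_n}, so that both
   positions and values range over {0, ..., n - 1}.  A choice of positions
   i_1 < ... < i_k is a strictly increasing i : {ffun 'I_k -> 'I_n}. *)

Definition increasing_positions (k n : nat) (i : {ffun 'I_k -> 'I_n}) : bool :=
  [forall a : 'I_k, forall b : 'I_k, (a < b) ==> (i a < i b)].

Definition order_isomorphic (k n : nat) (tau : 'S_k) (pi : 'S_n)
    (i : {ffun 'I_k -> 'I_n}) : bool :=
  [forall a : 'I_k, forall b : 'I_k,
    (pi (i a) < pi (i b)) == (tau a < tau b)].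

(* i_1 < j < i_k *)
Definition strictly_between_ends (k n : nat) (i : {ffun 'I_k -> 'I_n})
    (j : 'I_n) : bool :=
  [exists a : 'I_k, exists b : 'I_k,
    [&& a == 0 :> nat, b == k.-1 :> nat & i a < j < i b]].

(* All values are < n, so the default n of the minimum is never reached when
   0 < k. *)
Definition min_value (k n : nat) (pi : 'S_n) (i : {ffun 'I_k -> 'I_n}) : nat :=
  \big[minn/n]_(r < k) pi (i r).

Definition max_value (k n : nat) (pi : 'S_n) (i : {ffun 'I_k -> 'I_n}) : nat :=
  \max_(r < k) pi (i r).

Definition box_occurrence (k n : nat) (tau : 'S_k) (pi : 'S_n)
    (i : {ffun 'I_k -> 'I_n}) : bool :=
  [&& increasing_positions i, order_isomorphic tau pi i &
    ~~ [exists j : 'I_n,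
      [&& j \notin codom i, strictly_between_ends i j &
          min_value pi i < pi j < max_value pi i]]].

Definition num_box (k n : nat) (tau : 'S_k) (pi : 'S_n) : nat :=
  #|[set i : {ffun 'I_k -> 'I_n} | box_occurrence tau pi i]|.

Local Open Scope ring_scope.

Definition uniform_expectation (R : realFieldType) (T : finType)
    (X : T -> R) : R :=
  \sum_(t : T) #|T|%:R^-1 * X t.

Definition expected_num_box (R : realFieldType) (k n : nat) (tau : 'S_k) : R :=
  uniform_expectation (fun pi : 'S_n => (num_box tau pi)%:R).

Definition harmonic_number (R : realFieldType) (m : nat) : R :=
  \sum_(1 <= j < m.+1) j%:R^-1.

(* Main.v *)
Require Import Defs.
From HB Require Import structures.
From mathcomp Require Import all_boot all_order all_algebra all_fingroup.
From mathcomp Require Import zify ring.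

(** An occurrence of Box(tau) in pi is a sub-configuration of the graph of pi,
    and the graph treats positions and values alike.  So sum over both an
    increasing choice i of k positions and an increasing choice v of k values:
    pi has an occurrence of tau at i using the values v exactly when
    pi (i a) = v (tau a) for every a and every other position strictly between
    the ends of i is sent outside the closed interval spanned by v.  Writing
    k = K + 2 and n = N + 2, let x and y be the numbers of points strictly
    between the ends of i and of v.  Such a pi prescribes K + 2 values, sends
    x - K further points into a set of N - y values and is free elsewhere,
    which leaves (N - y) ^_ (x - K) * (N - x)! possibilities
    ([card_box_permutations]).  The pattern tau has disappeared, and that is
    the independence of tau.

    There are (N + 1 - x) 'C(x, K) increasing choices with interior size x
    ([sum_increasing]).  The sum over y is then a Vandermonde convolution in
    the upper indices ([sum_bin_mul_bin]) and collapses to a single binomial,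
    because (N + 1 - y) (N - y) ^_ (x - K) is itself a falling factorial.
    After division by n!, the choices of positions with interior x = K + t
    contribute
      (n - K - 1 - t) (t + 1) / ((K + t + 1) (K + t + 2)) / K!,
    and summing over t gives the harmonic numbers ([sum_window_weights]). *)

Set Implicit Arguments.
Unset Strict Implicit.
Unset Printing Implicit Defensive.

Import GRing.Theory.
Local Open Scope nat_scope.

(** * Permutations with prescribed values *)

(** Correcting a permutation that is already right on the tail by one
    transposition makes it right on the head as well. *)
Lemma perm_extension (T : finType) (xs ys : seq T) :
  uniq xs -> uniq ys -> size xs = size ys ->
  exists s : {perm T}, map s xs = ys.
Proof.
elim: xs ys => [|x xs IH] [|y ys] //=; first by exists 1%g.
case/andP=> x_xs uxs /andP[y_ys uys] [eq_sz].
have [s s_xs] := IH ys uxs uys eq_sz.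
exists (s * tperm (s x) y)%g; rewrite permM tpermL; congr (_ :: _).
rewrite -[RHS]s_xs; apply/eq_in_map => z z_xs; rewrite permM tpermD //.
  by apply: contraNneq x_xs => /perm_inj->.
by apply: contraNneq y_ys => ->; rewrite -s_xs map_f.
Qed.

(** The permutations in question form a coset of the permutations supported
    off xs. *)
Lemma card_perm_extending (T : finType) (xs ys : seq T) :
  uniq xs -> uniq ys -> size xs = size ys ->
  #|[set s : {perm T} | map s xs == ys]| = (#|T| - size xs)`!.
Proof.
move=> uxs uys eq_sz; have [s0 s0_xs] := perm_extension uxs uys eq_sz.
have -> : #|T| - size xs = #|[set x | x \notin xs]|.
  by rewrite -(cardC (mem xs)) (card_uniqP uxs) addKn cardsE; apply: eq_card.
rewrite -card_perm -(card_imset (mem (perm_on _)) (@mulIg _ s0)).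
apply: eq_card => s.
rewrite inE; apply/idP/imsetP => [/eqP s_xs | [t t_on ->]].
  exists (s * s0^-1)%g; last by rewrite mulgKV.
  apply/subsetP => x; rewrite !inE; apply: contra => x_xs.
  rewrite permM; apply/eqP; apply: (canLR (permK s0)).
  by move: x x_xs; apply/eq_in_map; rewrite s_xs s0_xs.
rewrite -s0_xs; apply/eqP/eq_in_map => x x_xs.
by rewrite permM (out_perm t_on) // inE negbK.
Qed.

(** The points of J are treated one at a time: choosing the image y of x in J
    turns x into a prescribed point and leaves J and C one element smaller. *)
Lemma card_perm_extending_into (T : finType) (xs ys : seq T) (J C : {set T}) :
  uniq xs -> uniq ys -> size xs = size ys ->
  {in J, forall x, x \notin xs} -> {in C, forall y, y \notin ys} ->
  #|[set s : {perm T} | (map s xs == ys) && [forall x in J, s x \in C]]|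
    = #|C| ^_ #|J| * (#|T| - size xs - #|J|)`!.
Proof.
move: {2}#|J| (erefl #|J|) => m; elim: m xs ys J C => [|m IH] xs ys J C cJ.
  move=> uxs uys eq_sz _ _; rewrite cJ ffactn0 mul1n subn0.
  rewrite -(card_perm_extending uxs uys eq_sz); apply: eq_card => s.
  rewrite !inE; case: eqP => //= _; apply/forall_inP => x.
  by rewrite (cards0_eq cJ) inE.
move=> uxs uys eq_sz J_xs C_ys.
have /card_gt0P[x xJ] : 0 < #|J| by rewrite cJ.
have cJ' : #|J :\ x| = m by apply/eqP; rewrite -eqSS -cJ (cardsD1 x J) xJ.
rewrite -sum1_card (partition_big (fun s : {perm T} => s x) (mem C)) /=; last first.
  by move=> s; rewrite inE => /andP[_ /forall_inP]; apply.
transitivity (\sum_(y in C) #|C|.-1 ^_ m * (#|T| - size xs - m.+1)`!).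
  apply: eq_bigr => y yC.
  have cC' : #|C :\ y| = #|C|.-1 by rewrite [in RHS](cardsD1 y C) yC.
  have -> : #|T| - size xs - m.+1 = #|T| - size (x :: xs) - #|J :\ x|.
    by rewrite cJ' /=; lia.
  rewrite -cC' -[in _ ^_ _]cJ' -(IH _ (y :: ys)) //=; last first.
  - move=> z; rewrite !inE => /andP[/negPf-> /C_ys]; exact.
  - move=> z; rewrite !inE => /andP[/negPf-> /J_xs]; exact.
  - by rewrite eq_sz.
  - by rewrite C_ys.
  - by rewrite J_xs.
  rewrite -sum1_card; apply: eq_bigl => s; rewrite !inE eqseq_cons.
  case: (s x =P y) => [sx|_]; last by rewrite andbF.
  rewrite andbT /=; congr (_ && _); apply/forall_inP/forall_inP => sJ z.
    rewrite !inE => /andP[zx /sJ->]; rewrite andbT -sx.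
    by apply: contraNneq zx => /perm_inj->.
  have [-> _|zx zJ] := eqVneq z x; first by rewrite sx.
  by have := sJ z; rewrite !inE zx zJ => /(_ isT) /andP[].
by rewrite sum_nat_const cJ ffactnS mulnA.
Qed.

(** * Binomial sums *)

(** Choose p + q + 1 points among M + 1 and let y be the one with p chosen
    points below it.  The proof is by Pascal's rule on the second factor. *)
Lemma sum_bin_mul_bin (M p q : nat) :
  \sum_(y < M.+1) 'C(y, p) * 'C(M - y, q) = 'C(M.+1, (p + q).+1).
Proof.
elim: q M => [|q IHq] M.
  rewrite addn0; elim: M => [|M IHM]; first by rewrite big_ord1 bin0 muln1; case: p.
  rewrite big_ord_recr /= bin0 muln1 binS -IHM; congr (_ + _).
  by apply: eq_bigr => y _; rewrite !bin0.
elim: M => [|M IHM]; first by rewrite big_ord1 bin0n muln0 bin_small // addnS.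
rewrite big_ord_recr /= subnn bin0n muln0 addn0 addnS binS.
rewrite -{1}addnS -IHM -IHq -big_split /=.
apply: eq_bigr => y _; rewrite -mulnDr subSn -1?ltnS // binS.
Qed.

(** The factor N + 1 - y completes the falling factorial (N - y) ^_ (x - K) to
    (N + 1 - y) ^_ (x - K + 1), a multiple of a binomial coefficient. *)
Lemma sum_falling_mul_bin (N K x : nat) : K <= x ->
  \sum_(y < N.+1) (N.+1 - y) * 'C(y, K) * (N - y) ^_ (x - K)
    = (x - K).+1`! * 'C(N.+2, x.+2).
Proof.
move=> leKx.
have -> : x.+2 = (K + (x - K).+1).+1 by lia.
(* The convolution has one more term, y = N + 1, which vanishes. *)
rewrite -sum_bin_mul_bin [in RHS]big_ord_recr /= subnn bin0n /=.
rewrite muln0 addn0 big_distrr /=.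
apply: eq_bigr => y _.
rewrite [RHS]mulnCA [_`! * _]mulnC bin_ffact subSn; last by rewrite -ltnS.
by rewrite ffactSS mulnCA mulnA.
Qed.

(** * Increasing choices of points *)

Lemma card_ord_lt (n b : nat) : b <= n -> #|[set c : 'I_n | c < b]| = b.
Proof.
move=> le_bn; transitivity (\sum_(c < b) 1); last first.
  by rewrite sum_nat_const card_ord muln1.
rewrite (big_ord_widen n (fun=> 1) le_bn) -sum1_card.
by apply: eq_bigl => c; rewrite inE.
Qed.

Lemma card_ord_between (n a b : nat) : a <= b <= n ->
  #|[set c : 'I_n | a <= c < b]| = b - a.
Proof.
case/andP=> le_ab le_bn; rewrite -[in RHS](card_ord_lt le_bn).
rewrite -[in RHS](card_ord_lt (leq_trans le_ab le_bn)) -cardsDS.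
  by apply: eq_card => c; rewrite !inE -leqNgt.
by apply/subsetP => c; rewrite !inE => /leq_trans->.
Qed.

Definition ord_ltn (n : nat) : rel 'I_n := fun x y => x < y.

Lemma ord_ltn_trans n : transitive (@ord_ltn n).
Proof. by move=> y x z; apply: ltn_trans. Qed.

Lemma ord_ltn_irr n : irreflexive (@ord_ltn n).
Proof. by move=> x; apply: ltnn. Qed.

Lemma sorted_enum_ord n (A : {set 'I_n}) : sorted (@ord_ltn n) (enum A).
Proof.
rewrite {1}/enum_mem -enumT; apply: (sorted_filter (@ord_ltn_trans n)).
by have := iota_ltn_sorted 0 n; rewrite -val_enum_ord sorted_map.
Qed.

Lemma increasing_positionsP (k n : nat) (i : {ffun 'I_k -> 'I_n}) :
  reflect {homo i : a b / a < b} (increasing_positions i).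
Proof.
apply: (iffP forallP) => [inc_i a b lt_ab | inc_i a].
  by have /forallP/(_ b)/implyP := inc_i a; apply.
by apply/forallP => b; apply/implyP; apply: inc_i.
Qed.

Lemma increasing_le (k n : nat) (i : {ffun 'I_k -> 'I_n}) :
  increasing_positions i -> {homo i : a b / a <= b}.
Proof.
move/increasing_positionsP=> inc_i a b; rewrite leq_eqVlt => /orP[/eqP|/inc_i/ltnW//].
by move/val_inj->.
Qed.

Lemma increasing_mono (k n : nat) (i : {ffun 'I_k -> 'I_n}) :
  increasing_positions i -> {mono i : a b / a < b}.
Proof.
move=> inc_i a b; apply/idP/idP => [|/(increasing_positionsP _ inc_i)//].
by apply: contraTT; rewrite -!leqNgt; apply: increasing_le.
Qed.

Lemma increasing_inj (k n : nat) (i : {ffun 'I_k -> 'I_n}) :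
  increasing_positions i -> injective i.
Proof.
move=> inc_i a b eq_ab; apply/val_inj/eqP => /=.
by rewrite eqn_leq leqNgt [b <= a]leqNgt -!(increasing_mono inc_i) eq_ab ltnn.
Qed.

Lemma increasing_sorted (k n : nat) (i : {ffun 'I_k -> 'I_n}) :
  increasing_positions i -> sorted (@ord_ltn n) (codom i).
Proof.
move/increasing_positionsP=> inc_i; apply: (homo_sorted inc_i).
by have := sorted_enum_ord [set: 'I_k]; rewrite enum_setT -enumT.
Qed.

Lemma increasing_eq_codom (k n : nat) (i i' : {ffun 'I_k -> 'I_n}) :
  increasing_positions i -> increasing_positions i' ->
  codom i =i codom i' -> i = i'.
Proof.
move=> inc_i inc_i' eq_ii'; apply/ffunP => a.
have := irr_sorted_eq (@ord_ltn_trans n) (@ord_ltn_irr n)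
  (increasing_sorted inc_i) (increasing_sorted inc_i') eq_ii'.
by move/eq_in_map; apply; rewrite mem_enum.
Qed.

(** An increasing map with given ends is determined by the image of the
    interior indices, an arbitrary K-element subset of the open interval. *)
Lemma card_increasing_with_ends (K n : nat) (a b : 'I_n) : a < b ->
  #|[set i : {ffun 'I_K.+2 -> 'I_n} |
      [&& increasing_positions i, i ord0 == a & i ord_max == b]]|
    = 'C((b - a).-1, K).
Proof.
move=> lt_ab; pose I := [set c : 'I_n | a < c < b].
have cI : #|I| = (b - a).-1.
  by rewrite card_ord_between ?lt_ab; [lia | rewrite ltnW].
rewrite -cI -cards_draws.
pose interior (i : {ffun 'I_K.+2 -> 'I_n}) :=
  i @: [set x : 'I_K.+2 | (ord0 : 'I_K.+2) < x < (ord_max : 'I_K.+2)].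
rewrite -(card_in_imset (f := interior)); last first.
  move=> i i'; rewrite !inE => /and3P[inc_i /eqP i0 /eqP i1].
  case/and3P=> inc_i' /eqP i'0 /eqP i'1 eq_int.
  apply: increasing_eq_codom => // c.
  have cod (f : {ffun 'I_K.+2 -> 'I_n}) :
     (c \in codom f) = [|| c == f ord0, c == f ord_max | c \in interior f].
    apply/codomP/or3P => [[x ->]|[/eqP->|/eqP->|/imsetP[x _ ->]]]; try by eexists.
    have [->|x0] := eqVneq x ord0; first by rewrite eqxx; constructor.
    have [->|x1] := eqVneq x ord_max; first by rewrite eqxx; constructor 2.
    constructor 3; apply: imset_f; rewrite inE lt0n x0 ltn_neqAle x1.
    by rewrite -ltnS ltn_ord.
  by rewrite !cod i0 i'0 i1 i'1 eq_int.
apply: eq_card => A; rewrite inE; apply/imsetP/andP => [[i]|[sAI /eqP cA]].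
  rewrite inE => /and3P[inc_i /eqP i0 /eqP i1] ->; split.
    apply/subsetP => _ /imsetP[x x_int ->]; move: x_int.
    by rewrite !inE -i0 -i1 !(increasing_mono inc_i).
  rewrite card_imset; last exact: increasing_inj.
  by rewrite card_ord_between //=; lia.
(* The map with interior image A lists a, then A in increasing order, then b. *)
pose s := a :: rcons (enum A) b.
have sz_s : size s = K.+2 by rewrite /= size_rcons -cardE cA.
have sorted_s : sorted (@ord_ltn n) s.
  have AI c : c \in A -> a < c < b by move/(subsetP sAI); rewrite inE.
  rewrite /= rcons_path path_sortedE; last exact: ord_ltn_trans.
  rewrite sorted_enum_ord andbT; apply/andP; split.
    by apply/allP => c; rewrite mem_enum => /AI/andP[].
  have := mem_last a (enum A); rewrite inE mem_enum.
  by case/orP=> [/eqP-> //|/AI/andP[]].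
pose i := [ffun x : 'I_K.+2 => nth a s x].
have inc_i : increasing_positions i.
  apply/increasing_positionsP => x y lt_xy; rewrite !ffunE.
  by apply: (sorted_ltn_nth (@ord_ltn_trans n)) => //; rewrite inE sz_s.
have i0 : i ord0 = a by rewrite ffunE.
have i1 : i ord_max = b.
  by rewrite ffunE /= nth_rcons -cardE cA ltnn eqxx.
exists i; first by rewrite inE inc_i i0 i1 !eqxx.
apply/setP => c; apply/idP/imsetP => [cA'|[x x_int ->]].
  have c_s : c \in s by rewrite inE mem_rcons inE mem_enum cA' !orbT.
  have lt_idx : index c s < K.+2 by rewrite -sz_s index_mem.
  have ic : i (Ordinal lt_idx) = c by rewrite ffunE /= nth_index.
  exists (Ordinal lt_idx) => //; rewrite inE -!(increasing_mono inc_i) i0 i1 ic.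
  by have := subsetP sAI c cA'; rewrite inE.
move: x_int; rewrite inE -!(increasing_mono inc_i) i0 i1 => /andP[lt_a lt_b].
have : i x \in s by rewrite ffunE mem_nth ?sz_s.
rewrite inE mem_rcons inE mem_enum.
by case/or3P=> // /eqP e; rewrite e ltnn in lt_a lt_b.
Qed.

Lemma sum_ord_pairs (n : nat) (G : nat -> nat) :
  \sum_(b < n) \sum_(a < n | a < b) G (b - a).-1 = \sum_(x < n.-1) (n.-1 - x) * G x.
Proof.
transitivity (\sum_(b < n) \sum_(x < b) G x).
  apply: eq_bigr => b _.
  rewrite -(big_ord_widen _ (fun a => G (b - a).-1) (ltnW (ltn_ord b))).
  rewrite (reindex_inj rev_ord_inj) /=; apply: eq_bigr => x _.
  by congr G; have := ltn_ord x; lia.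
elim: n => [|[|n] IHn]; first by rewrite !big_ord0.
  by rewrite big_ord1 !big_ord0.
rewrite big_ord_recr IHn /= [in LHS]big_ord_recr [in RHS]big_ord_recr /=.
rewrite subSnn mul1n addnA -big_split /=.
congr (_ + _); apply: eq_bigr => x _.
by rewrite subSn ?mulSn 1?addnC // ltnW.
Qed.

(** An interior size x occurs for n - 1 - x pairs of ends, and for each of them
    'C(x, K) increasing maps. *)
Lemma sum_increasing (K n : nat) (F : nat -> nat) :
  \sum_(i : {ffun 'I_K.+2 -> 'I_n} | increasing_positions i)
     F (i ord_max - i ord0).-1
  = \sum_(x < n.-1) (n.-1 - x) * ('C(x, K) * F x).
Proof.
rewrite -(sum_ord_pairs n (fun x => 'C(x, K) * F x)) pair_big_dep /=.
rewrite (partition_big (fun i : {ffun 'I_K.+2 -> 'I_n} => (i ord_max, i ord0))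
           (fun p => p.2 < p.1)) /=; last first.
  by move=> i /increasing_positionsP; apply.
apply: eq_bigr => -[b a] /= lt_ab.
rewrite -(card_increasing_with_ends K lt_ab) -sum_nat_const.
rewrite big_mkcond [RHS]big_mkcond /=.
apply: eq_bigr => i _; rewrite inE xpair_eqE.
by case: (increasing_positions i) => //=; case: eqP => [->|]; case: eqP => [->|].
Qed.

(** * Permutations with a given box occurrence *)

Lemma strictly_between_endsE (K n : nat) (i : {ffun 'I_K.+2 -> 'I_n}) (j : 'I_n) :
  strictly_between_ends i j = (i ord0 < j < i ord_max).
Proof.
apply/existsP/idP => [[a /existsP[b /and3P[/eqP a0 /eqP b1]]]|lt_j].
  by have -> : a = ord0 by [apply: val_inj]; have -> : b = ord_max by apply: val_inj.
by exists ord0; apply/existsP; exists ord_max; rewrite !eqxx.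
Qed.

(** All K + 2 points of i lie in the closed interval between its ends, so the
    remaining positions are counted by a subtraction of cardinals. *)
Lemma card_box_interior (K n : nat) (i : {ffun 'I_K.+2 -> 'I_n}) :
  increasing_positions i ->
  #|[set j : 'I_n | (j \notin codom i) && (i ord0 < j < i ord_max)]|
    = (i ord_max - i ord0).-1 - K.
Proof.
move=> inc_i; have lt_ends : i ord0 < i ord_max by rewrite increasing_mono.
have -> : [set j : 'I_n | (j \notin codom i) && (i ord0 < j < i ord_max)]
    = [set j : 'I_n | i ord0 <= j < (i ord_max).+1] :\: [set j in codom i].
  apply/setP => j; rewrite !inE; case: (boolP (j \in codom i)) => //= j_i.
  rewrite ltnS !ltn_neqAle; congr (_ && _).
    rewrite -[RHS]andTb; congr (_ && _).
    by apply: contraNneq j_i => /val_inj <-; apply: codom_f.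
  rewrite -[RHS]andTb; congr (_ && _).
  by apply: contraNneq j_i => /val_inj->; apply: codom_f.
rewrite cardsDS; last first.
  apply/subsetP => j; rewrite !inE => /codomP[a ->].
  by rewrite ltnS !(increasing_le inc_i) // -ltnS.
rewrite card_ord_between; last by rewrite ltn_ord leqW // ltnW.
rewrite cardsE card_codom; last exact: increasing_inj.
by rewrite card_ord; lia.
Qed.

Lemma min_valueE (K n : nat) (tau : 'S_K.+2) (pi : 'S_n)
    (i v : {ffun 'I_K.+2 -> 'I_n}) :
  increasing_positions v -> (forall a, pi (i a) = v (tau a)) ->
  min_value pi i = v ord0.
Proof.
move=> inc_v pi_i; apply/eqP; rewrite eqn_leq /min_value -Order.NatOrder.minEnat.
apply/andP; split.
  have -> : v ord0 = pi (i (tau^-1 ord0)%g) by rewrite pi_i permKV.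
  by have := Order.TotalTheory.bigmin_le n (tau^-1 ord0)%g (fun r => pi (i r) : nat).
apply: (@Order.POrderTheory.le_bigmin _ nat); first by rewrite leEnat ltnW.
by move=> r _; rewrite leEnat pi_i increasing_le.
Qed.

Lemma max_valueE (K n : nat) (tau : 'S_K.+2) (pi : 'S_n)
    (i v : {ffun 'I_K.+2 -> 'I_n}) :
  increasing_positions v -> (forall a, pi (i a) = v (tau a)) ->
  max_value pi i = v ord_max.
Proof.
move=> inc_v pi_i; apply/eqP; rewrite eqn_leq; apply/andP; split.
  by apply/bigmax_leqP => r _; rewrite pi_i increasing_le // -ltnS.
have -> : v ord_max = pi (i (tau^-1 ord_max)%g) by rewrite pi_i permKV.
exact: (leq_bigmax (F := fun r => pi (i r) : nat)).
Qed.

(** The value choice v attached to an occurrence: the entries of pi at i,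
    reordered by tau, are increasing exactly when they form the pattern tau. *)
Definition sorted_values (k n : nat) (tau : 'S_k) (pi : 'S_n)
    (i : {ffun 'I_k -> 'I_n}) : {ffun 'I_k -> 'I_n} :=
  [ffun b => pi (i (tau^-1 b)%g)].

Lemma sorted_valuesP (k n : nat) (tau : 'S_k) (pi : 'S_n)
    (i v : {ffun 'I_k -> 'I_n}) :
  reflect (forall a, pi (i a) = v (tau a)) (sorted_values tau pi i == v).
Proof.
apply: (iffP eqP) => [<- a|pi_i]; first by rewrite ffunE permK.
by apply/ffunP => b; rewrite ffunE pi_i permKV.
Qed.

Lemma increasing_sorted_values (k n : nat) (tau : 'S_k) (pi : 'S_n)
    (i : {ffun 'I_k -> 'I_n}) :
  increasing_positions (sorted_values tau pi i) = order_isomorphic tau pi i.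
Proof.
apply/idP/forallP => [inc_v a | iso_i].
  apply/forallP => b.
  have pi_i := sorted_valuesP tau pi i _ (eqxx _).
  by rewrite !pi_i (increasing_mono inc_v).
apply/increasing_positionsP => a b lt_ab; rewrite !ffunE.
by have /forallP/(_ (tau^-1 b)%g)/eqP-> := iso_i (tau^-1 a)%g; rewrite !permKV.
Qed.

(** The strict bounds on the values in a box become weak ones, because a
    position outside i cannot take an extreme value of v.  The forbidden values
    are then a whole closed interval, of a size depending only on v. *)
Lemma box_occurrenceE (K n : nat) (tau : 'S_K.+2) (pi : 'S_n)
    (i v : {ffun 'I_K.+2 -> 'I_n}) :
  increasing_positions i -> increasing_positions v ->
  (forall a, pi (i a) = v (tau a)) ->
  box_occurrence tau pi i
    = [forall j in [set j : 'I_n | (j \notin codom i) && (i ord0 < j < i ord_max)],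
         pi j \in ~: [set y : 'I_n | v ord0 <= y < (v ord_max).+1]].
Proof.
move=> inc_i inc_v pi_i; rewrite /box_occurrence inc_i -increasing_sorted_values.
rewrite (eqP (introT (sorted_valuesP tau pi i v) pi_i)) inc_v /=.
rewrite (min_valueE inc_v pi_i) (max_valueE inc_v pi_i) negb_exists.
apply: eq_forallb => j; rewrite !inE strictly_between_endsE ltnS.
case: (boolP (j \in codom i)) => //= j_i; case: (i ord0 < j < _) => //=; congr (~~ _).
have pi_j b : pi j != v b.
  apply: contraNneq j_i; rewrite -[b](permKV tau) -pi_i => /perm_inj->.
  exact: codom_f.
rewrite !ltn_neqAle; congr (_ && _); rewrite -[RHS]andTb; congr (_ && _).
  by rewrite eq_sym; apply: pi_j.
exact: pi_j.
Qed.

Lemma card_box_permutations (K N : nat) (tau : 'S_K.+2)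
    (i v : {ffun 'I_K.+2 -> 'I_N.+2}) :
  increasing_positions i -> increasing_positions v ->
  let x := (i ord_max - i ord0).-1 in let y := (v ord_max - v ord0).-1 in
  #|[set pi : 'S_N.+2 | box_occurrence tau pi i & sorted_values tau pi i == v]|
    = (N - y) ^_ (x - K) * (N - x)`!.
Proof.
move=> inc_i inc_v x y.
pose J := [set j : 'I_N.+2 | (j \notin codom i) && (i ord0 < j < i ord_max)].
pose C := ~: [set y : 'I_N.+2 | v ord0 <= y < (v ord_max).+1].
pose ys := [seq v (tau a) | a <- enum 'I_K.+2].
have lt_ends (u : {ffun 'I_K.+2 -> 'I_N.+2}) : increasing_positions u ->
    u ord0 < u ord_max by move=> inc_u; rewrite increasing_mono.
have cJ : #|J| = x - K by exact: card_box_interior.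
have cC : #|C| = N - y.
  rewrite cardsCs setCK card_ord_between; last first.
    by rewrite ltn_ord leqW // ltnW // lt_ends.
  by have := lt_ends v inc_v; rewrite card_ord /y; lia.
have leKx : K <= x.
  have : #|[set j in codom i]| <= #|[set j : 'I_N.+2 | i ord0 <= j < (i ord_max).+1]|.
    apply/subset_leq_card/subsetP => j; rewrite !inE => /codomP[a ->].
    by rewrite ltnS !(increasing_le inc_i) // -ltnS.
  rewrite cardsE card_codom; last exact: increasing_inj.
  rewrite card_ord_between; last by rewrite ltn_ord leqW // ltnW // lt_ends.
  by rewrite card_ord /x; have := lt_ends i inc_i; lia.
have := @card_perm_extending_into _ (codom i) ys J C.
rewrite card_ord size_codom card_ord cJ cC.
have -> : N.+2 - K.+2 - (x - K) = N - x by lia.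
move=> <-; first last.
- move=> z; rewrite !inE; apply: contra => /mapP[a _ ->].
  by rewrite ltnS !(increasing_le inc_v) // -ltnS.
- by move=> z; rewrite inE => /andP[].
- by rewrite size_map size_enum_ord.
- by rewrite map_inj_uniq ?enum_uniq // => a b /(increasing_inj inc_v)/perm_inj.
- by apply/injectiveP/increasing_inj.
apply: eq_card => pi; rewrite !inE andbC.
have -> : (map pi (codom i) == ys) = (sorted_values tau pi i == v).
  rewrite /codom /image_mem -map_comp.
  apply/eqP/sorted_valuesP => [/eq_in_map pi_i a|pi_i]; last exact/eq_map.
  by apply: (pi_i a); rewrite mem_enum.
by case: sorted_valuesP => //= pi_i; rewrite (box_occurrenceE inc_i inc_v pi_i).
Qed.

(** The double sum over positions and values; the falling factorial sum disposes
    of the values. *)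
Lemma sum_num_box (K N : nat) (tau : 'S_K.+2) :
  \sum_(pi : 'S_N.+2) num_box tau pi
    = \sum_(x < N.+1) (N.+1 - x) * 'C(x, K) *
        ((x - K).+1`! * (N - x)`! * 'C(N.+2, x.+2)).
Proof.
transitivity (\sum_(i : {ffun 'I_K.+2 -> 'I_N.+2} | increasing_positions i)
    \sum_(v : {ffun 'I_K.+2 -> 'I_N.+2} | increasing_positions v)
      (N - (v ord_max - v ord0).-1) ^_ ((i ord_max - i ord0).-1 - K)
        * (N - (i ord_max - i ord0).-1)`!).
  transitivity (\sum_(i : {ffun 'I_K.+2 -> 'I_N.+2} | increasing_positions i)
     \sum_(pi : 'S_N.+2 | box_occurrence tau pi i) 1).
    rewrite (exchange_big_dep predT) //=; apply: eq_bigr => pi _.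
    rewrite /num_box -sum1_card; apply: eq_bigl => i.
    by rewrite inE /box_occurrence; case: increasing_positions.
  apply: eq_bigr => i inc_i.
  rewrite (partition_big (fun pi => sorted_values tau pi i)
             (@increasing_positions K.+2 N.+2)) /=; last first.
    by move=> pi /and3P[]; rewrite increasing_sorted_values.
  apply: eq_bigr => v inc_v; rewrite -(card_box_permutations tau inc_i inc_v).
  by rewrite -sum1_card; apply: eq_bigl => pi; rewrite inE.
rewrite (sum_increasing K N.+2 (fun x =>
  \sum_(v : {ffun 'I_K.+2 -> 'I_N.+2} | increasing_positions v)
      (N - (v ord_max - v ord0).-1) ^_ (x - K) * (N - x)`!)) /=.
apply: eq_bigr => x _; rewrite mulnA.
(* For x < K the truncated difference x - K is meaningless, but then the
   binomial coefficient vanishes. *)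
have [lt_xK | leKx] := ltnP x K; first by rewrite bin_small ?muln0.
congr (_ * _); rewrite -big_distrl /=.
rewrite (sum_increasing K N.+2 (fun y => (N - y) ^_ (x - K))) /=.
rewrite mulnAC -sum_falling_mul_bin //; congr (_ * _).
by apply: eq_bigr => y _; rewrite mulnA.
Qed.

(** * Harmonic sums *)

Local Open Scope ring_scope.

Lemma harmonic_numberS (R : realFieldType) (m : nat) :
  harmonic_number R m.+1 = harmonic_number R m + m.+1%:R^-1.
Proof. by rewrite /harmonic_number big_nat_recr. Qed.

(** Partial fractions: t + 1 over (K + t + 1) (K + t + 2) is
    (K + 1) / (K + t + 2) - K / (K + t + 1). *)
Lemma sum_gap_weights (R : realFieldType) (K M : nat) :
  \sum_(t < M) t.+1%:R / ((K + t).+1%:R * (K + t).+2%:R)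
    = harmonic_number R (K + M).+1 - harmonic_number R K
      + K%:R / (K + M).+1%:R - 1 :> R.
Proof.
have nz m : m.+1%:R != 0 :> R by rewrite Num.Theory.pnatr_eq0.
elim: M => [|M IHM].
  by rewrite big_ord0 addn0 harmonic_numberS; have := nz K; rewrite mulrS => ?; field.
rewrite big_ord_recr /= IHM addnS (harmonic_numberS R (K + M).+1).
move: (nz (K + M)%N) (nz (K + M).+1); rewrite !mulrS !natrD => ? ?.
by field; apply/andP; split.
Qed.

(** Raising M by one raises the coefficient of every term by one, so the
    increment is the sum of the unweighted terms. *)
Lemma sum_window_weights (R : realFieldType) (K M : nat) :
  \sum_(t < M.+1) (M.+1 - t)%:R * t.+1%:R / ((K + t).+1%:R * (K + t).+2%:R)
    = (2 * K%:R + M%:R + 3) * (harmonic_number R (K + M).+2 - harmonic_number R K)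
      - 2 * (M%:R + 2) :> R.
Proof.
have nz m : m.+1%:R != 0 :> R by rewrite Num.Theory.pnatr_eq0.
elim: M => [|M IHM].
  rewrite big_ord1 addn0 !harmonic_numberS /=.
  move: (nz K) (nz K.+1); rewrite !mulrS => ? ?.
  by field; apply/andP; split.
have -> : \sum_(t < M.+2) (M.+2 - t)%:R * t.+1%:R / ((K + t).+1%:R * (K + t).+2%:R)
   = \sum_(t < M.+1) (M.+1 - t)%:R * t.+1%:R / ((K + t).+1%:R * (K + t).+2%:R)
     + \sum_(t < M.+2) t.+1%:R / ((K + t).+1%:R * (K + t).+2%:R) :> R.
  rewrite big_ord_recr [X in _ = _ + X]big_ord_recr /= subSnn mul1r addrA.
  congr (_ + _); rewrite -big_split; apply: eq_bigr => t _ /=.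
  by rewrite subSn 1?ltnW // -addn1 natrD !mulrDl mul1r.
rewrite IHM sum_gap_weights !addnS !harmonic_numberS.
move: (nz (K + M)%N) (nz (K + M).+1) (nz (K + M).+2); rewrite !mulrS !natrD => ? ? ?.
by field; repeat (apply/andP; split).
Qed.

(** All factorials cancel except K!, two consecutive factors of (K + t + 2)!,
    and the factor t + 1 of (t + 1)!. *)
Lemma gap_weightE (R : realFieldType) (K n t : nat) : (K + t.+2 <= n)%N ->
  n`!%:R^-1 * ('C(K + t, K) * (t.+1`! * (n - (K + t).+2)`! * 'C(n, (K + t).+2)))%:R
    = t.+1%:R / ((K + t).+1%:R * (K + t).+2%:R) / K`!%:R :> R.
Proof.
move=> le_n; have nz m : m.+1%:R != 0 :> R by rewrite Num.Theory.pnatr_eq0.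
have fnz m : m`!%:R != 0 :> R by rewrite Num.Theory.pnatr_eq0 -lt0n fact_gt0.
rewrite -(@bin_fact n (K + t).+2) -?addnS // !addnS.
set r := (n - _)`!; have rnz : r%:R != 0 :> R by exact: fnz.
rewrite [(K + t).+2`!]factS [(K + t).+1`!]factS.
rewrite -(@bin_fact (K + t) K) ?leq_addr // addKn [t.+1`!]factS.
have Cnz m k : (k <= m)%N -> 'C(m, k)%:R != 0 :> R.
  by move=> ?; rewrite Num.Theory.pnatr_eq0 -lt0n bin_gt0.
have c1 := Cnz (K + t)%N K (leq_addr _ _).
have c2 : 'C(n, (K + t).+2)%:R != 0 :> R by apply: Cnz; rewrite -!addnS.
move: (nz (K + t)%N) (nz (K + t).+1) (fnz K) (fnz t).
rewrite !natrM => ? ? ? ?.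
by field; rewrite -natrD -(natrD _ 2) -mulrS; repeat (apply/andP; split).
Qed.

(** * The expectation *)

(** The terms with interior size x < K vanish, and x = K + t turns the others
    into those of [sum_window_weights], divided by K!. *)
Lemma expected_num_boxE (R : realFieldType) (K M : nat) (tau : 'S_K.+2) :
  expected_num_box R (K + M).+2 tau
    = ((2 * K%:R + M%:R + 3) *
         (harmonic_number R (K + M).+2 - harmonic_number R K)
       - 2 * (M%:R + 2)) / K`!%:R.
Proof.
rewrite /expected_num_box /uniform_expectation -big_distrr /= card_Sn.
rewrite -natr_sum sum_num_box natr_sum big_distrr /= -sum_window_weights.
rewrite -addnS big_split_ord /= big1 ?add0r; last first.
  by move=> x _; rewrite bin_small ?muln0 ?mul0n ?mulr0.
rewrite big_distrl /=; apply: eq_bigr => t _.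
transitivity ((M.+1 - t)%:R * (t.+1%:R / ((K + t).+1%:R * (K + t).+2%:R) / K`!%:R) : R);
  last by rewrite !mulrA.
rewrite addKn -(@gap_weightE R K (K + M).+2 t); last first.
  by rewrite !addnS !ltnS leq_add2l -ltnS.
have -> : ((K + M.+1) - (K + t) = M.+1 - t)%N by rewrite subnDl.
have -> : ((K + M).+2 - (K + t).+2 = (K + M) - (K + t))%N by [].
by rewrite -mulnA natrM mulrCA addnS.
Qed.

Theorem proposition6p4 (R : realFieldType) :
  [/\ forall (k n : nat) (tau : 'S_k), (2 <= k)%N -> (k <= n)%N ->
        expected_num_box R n tau =
          ((n%:R + k%:R - 1) * (harmonic_number R n - harmonic_number R (k - 2))
             - 2 * (n%:R - k%:R + 2)) / ((k - 2)`!)%:R,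
      forall n : nat, (3 <= n)%N ->
        expected_num_box R n (1%g : 'S_3) =
          (n%:R + 2) * harmonic_number R n - 3 * n%:R
    & forall (k n : nat) (tau sigma : 'S_k), (2 <= k)%N -> (k <= n)%N ->
        expected_num_box R n tau = expected_num_box R n sigma].
Proof.
have main (k n : nat) (tau : 'S_k) : (2 <= k)%N -> (k <= n)%N ->
    expected_num_box R n tau =
      ((n%:R + k%:R - 1) * (harmonic_number R n - harmonic_number R (k - 2))
         - 2 * (n%:R - k%:R + 2)) / ((k - 2)`!)%:R.
  case: k tau => [|[|K]] // tau _ le_kn.
  have -> : n = (K + (n - K.+2)).+2 by rewrite -!addSn subnKC.
  rewrite expected_num_boxE !subSS subn0 !mulrS natrD.
  by congr ((_ * _ - _ * _) / _); ring.
split=> [||k n tau sigma le2k le_kn]; first exact: main.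
  move=> n le3n; rewrite main // (_ : 3 - 2 = 1)%N // (_ : 1`! = 1)%N //.
  rewrite (harmonic_numberS R 0) [harmonic_number R 0]big_geq //.
  by field.
by rewrite !main.
Qed.
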